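(* Assume that the polarisation type is square-free and coprime, i.e. every $d_i$ is square-free and $\gcd(d_i,d_j)=1$ for all $i\ne j$. Then $\tilde\Gamma_{\mathrm{pol}}$ acts transitively on the set of $g$-dimensional isotropic subspaces of $\mathbb{Q}^{2g}$.
   Context: Let $g$ be a positive integer and $d_1,\dots,d_{g-1}$ positive integers. Put $d_{i:j}=\prod_{n=i}^{j}d_n$ for $i\le j$ and $d_{i:j}=1$ for $i>j$. The polarisation type is $(1,d_1,d_{1:2},\dots,d_{1:g-1})$; let $\Delta=\operatorname{diag}(1,d_1,d_{1:2},\dots,d_{1:g-1})$ and $\Lambda=\begin{pmatrix}0&\Delta\\-\Delta&0\end{pmatrix}$. Vectors are row vectors and $\langle x,y\rangle=x\Lambda\,{}^t y$. A subspace $V\subset\mathbb{Q}^{2g}$ is isotropic if $\langle u,v\rangle=0$ for all $u,v\in V$. The group $$\tilde\Gamma_{\mathrm{pol}}=\{M\in \mathrm{SL}(2g,\mathbb{Z}): M\Lambda\,{}^tM=\Lambda\}$$ acts on $\mathbb{Q}^{2g}$ by right multiplication on row vectors, and hence on isotropic subspaces. *)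

(* Defs.v *)
From HB Require Import structures.
From mathcomp Require Import all_boot all_order all_algebra.
Set Implicit Arguments.
Unset Strict Implicit.
Unset Printing Implicit Defensive.
Import Order.TTheory GRing.Theory Num.Theory.
Local Open Scope ring_scope.

Definition squarefree (n : nat) : Prop :=
  forall m : nat, (m ^ 2 %| n)%N -> m = 1%N.

(* d_{i:j}; the range is empty, hence the product is 1, when i > j.  Only the
   values d 1, ..., d g.-1 of the sequence d are ever used. *)
Definition dprod (d : nat -> nat) (i j : nat) : nat :=
  (\prod_(i <= n < j.+1) d n)%N.

(* The 0-based diagonal index i carries d_{1:i}, so the first entry is
   d_{1:0} = 1. *)
Definition pol_Delta (g : nat) (d : nat -> nat) : 'M[int]_g :=
  diag_mx (\row_(i < g) (dprod d 1 i)%:Z).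

Definition pol_Lambda (g : nat) (d : nat -> nat) : 'M[int]_(g + g) :=
  block_mx 0 (pol_Delta g d) (- pol_Delta g d) 0.

Definition pol_form (g : nat) (d : nat -> nat) (x y : 'rV[rat]_(g + g)) : rat :=
  (x *m map_mx intr (pol_Lambda g d) *m y^T) 0 0.

Definition isotropic (g : nat) (d : nat -> nat)
    (V : {vspace 'rV[rat]_(g + g)}) : Prop :=
  forall u v, u \in V -> v \in V -> pol_form d u v = 0.

Definition Gamma_pol (g : nat) (d : nat -> nat) (M : 'M[int]_(g + g)) : Prop :=
  \det M = 1 /\ M *m pol_Lambda g d *m M^T = pol_Lambda g d.

Definition subspace_act (n : nat) (V : {vspace 'rV[rat]_n}) (M : 'M[int]_n) :
    {vspace 'rV[rat]_n} :=
  (linfun (mulmxr (map_mx intr M)) @: V)%VS.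

(* S is stable under the action of G and forms exactly one orbit.  MathComp's
   atrans, which also entails that S is nonempty, only covers finite groups. *)
Definition acts_transitively (T X : Type) (G : T -> Prop) (act : X -> T -> X)
    (S : X -> Prop) : Prop :=
  [/\ forall x a, S x -> G a -> S (act x a),
      exists x, S x
    & forall x y, S x -> S y -> exists2 a, G a & act x a = y].

(* Main.v *)
Require Import Defs.
From mathcomp Require Import all_boot all_order all_algebra.
From mathcomp Require Import all_field ring zify.
Set Implicit Arguments.
Unset Strict Implicit.
Unset Printing Implicit Defensive.
Import Order.TTheory GRing.Theory Num.Theory.
Local Open Scope ring_scope.

(** For a Lagrangian V, extend a basis X of the primitive lattice of integral
    points of V to a basis (X, Y) of Z^2g; by Smith normal form the Gram matrix
    G can be taken to be [[0, A], [-A, B]] with A = diag(a_0 | a_1 | ...) and B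
    alternating.  Let D = d_{1:g-1}.  Since D G^-1 is integral, a_i divides D
    and a_i a_k divides D B_ik.  Moreover det A = det Delta, and D is square-free;
    counting the a_i divisible by each prime forces A = Delta.  As d_{1:i} is
    coprime to D / d_{1:k} for i <= k, it divides B_ik, so B can be removed by
    adding integral combinations of X to Y.  Thus every Lagrangian is spanned
    by the first g rows of a matrix U with U Lambda U^T = Lambda, and any two
    such matrices differ by an isometry, whose determinant is 1. *)

(** * Row spaces as subspaces of row vectors *)

Definition rowspace (F : fieldType) (m n : nat) (A : 'M[F]_(m, n)) :
    {vspace 'rV[F]_n} := limg (linfun (mulmxr A : 'rV[F]_m -> 'rV[F]_n)).

Lemma mem_rowspace (F : fieldType) (m n : nat) (A : 'M[F]_(m, n)) v :
  reflect (exists u : 'rV_m, v = u *m A) (v \in rowspace A).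
Proof.
apply: (iffP memv_imgP) => [[u _ ->]|[u ->]].
  by exists u; rewrite lfunE.
by exists u; rewrite ?memvf // lfunE.
Qed.

Lemma rowspace_unitmx (F : fieldType) (m n : nat) (P : 'M[F]_m)
    (A : 'M[F]_(m, n)) : P \in unitmx -> rowspace (P *m A) = rowspace A.
Proof.
move=> Pu; apply/vspaceP => v; apply/mem_rowspace/mem_rowspace => -[u ->].
  by exists (u *m P); rewrite mulmxA.
by exists (u *m invmx P); rewrite mulmxA mulmxKV.
Qed.

Lemma dim_rowspace (F : fieldType) (m n : nat) (A : 'M[F]_(m, n)) :
  row_free A -> \dim (rowspace A) = m.
Proof.
move=> /row_freeP[B AB]; rewrite limg_dim_eq; first by rewrite dimvf /dim /= mul1n.
apply/eqP; rewrite -subv0 capfv; apply/subvP => u; rewrite memv_ker lfunE /=.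
move=> /eqP uA; rewrite memv0 -[u]mulmx1 -AB mulmxA uA mul0mx //.
Qed.

Lemma ex_rowspace (F : fieldType) (m n : nat) (V : {vspace 'rV[F]_n}) :
  \dim V = m -> exists2 A : 'M[F]_(m, n), row_free A & V = rowspace A.
Proof.
move=> <-; pose A : 'M_(\dim V, n) := \matrix_i (vbasis V)`_i.
have rA i : row i A = (vbasis V)`_i by apply: rowK.
exists A.
  rewrite -kermx_eq0; apply/eqP/row_matrixP => i; rewrite row0.
  have : row i (kermx A) *m A = 0 by rewrite -row_mul mulmx_ker row0.
  rewrite mulmx_sum_row; under eq_bigr do rewrite rA.
  have /freeP h := basis_free (vbasisP V).
  by move=> /h h'; apply/rowP => j; rewrite h' mxE.
apply/vspaceP => v; apply/idP/mem_rowspace => [Vv|[u ->]].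
  exists (\row_i coord (vbasis V) i v).
  rewrite {1}(coord_vbasis Vv) mulmx_sum_row.
  by apply: eq_bigr => i _; rewrite rA mxE.
rewrite mulmx_sum_row; apply: memv_suml => i _.
by rewrite rA memvZ // vbasis_mem // mem_nth // size_tuple.
Qed.

Lemma subspace_act_rowspace (m n : nat) (A : 'M[rat]_(m, n)) (M : 'M[int]_n) :
  subspace_act (rowspace A) M = rowspace (A *m map_mx intr M).
Proof.
apply/vspaceP => v; apply/memv_imgP/mem_rowspace => [[w /mem_rowspace[u ->] ->]|[u ->]].
  by exists u; rewrite lfunE /= mulmxA.
exists (u *m A); last by rewrite lfunE /= mulmxA.
by apply/mem_rowspace; exists u.
Qed.

Lemma isotropic_rowspace (g m : nat) (d : nat -> nat) (A : 'M[rat]_(m, g + g)) :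
  isotropic d (rowspace A) <->
  A *m map_mx intr (pol_Lambda g d) *m A^T = 0.
Proof.
split=> [h|h u v /mem_rowspace[x ->] /mem_rowspace[y ->]]; last first.
  rewrite /pol_form trmx_mul !mulmxA -(mulmxA (x *m A)) -!mulmxA.
  by rewrite [A *m _]mulmxA [A *m _ *m _]mulmxA h mul0mx mulmx0 mxE.
have rA i : row i A \in rowspace A.
  by apply/mem_rowspace; exists (delta_mx 0 i); rewrite -rowE.
apply/matrixP => i j; rewrite [RHS]mxE -(h _ _ (rA i) (rA j)) /pol_form.
rewrite -row_mul !mxE; apply: eq_bigr => k _; by rewrite !mxE.
Qed.

(** * Integral bases of rational subspaces *)

Lemma map_intr_inj (m n : nat) :
  injective (map_mx (intr : int -> rat) : 'M_(m, n) -> _).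
Proof.
move=> A B /matrixP AB; apply/matrixP => i j; have := AB i j.
by rewrite !mxE => /intr_inj.
Qed.

Lemma clear_denominators (m n : nat) (A : 'M[rat]_(m, n)) :
  exists2 q : int, q != 0 & exists N : 'M[int]_(m, n), map_mx intr N = q%:~R *: A.
Proof.
pose q : int := \prod_i \prod_j denq (A i j).
exists q; first by apply/prodf_neq0 => i _; apply/prodf_neq0 => j _; apply: denq_neq0.
(* Each entry of [A] becomes an integer when multiplied by [q], so [Num.floor] loses nothing. *)
exists (\matrix_(i, j) Num.floor (q%:~R * A i j)); apply/matrixP => i j; rewrite !mxE.
apply/eqP; rewrite -intrEfloor; apply/intrP.
rewrite /q (bigD1 i) //= (bigD1 j) //=.
set x := \prod_(_ < _ | _) _; set y := \prod_(_ < _ | _) _.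
exists (numq (A i j) * x * y).
by rewrite !rmorphM /= numqE; ring.
Qed.

(** In a Smith decomposition of an integral matrix spanning [V], the right factor is unimodular, and
    its first [m] rows differ from the spanning rows only by a matrix invertible over the
    rationals. *)
Lemma primitive_basis (m n : nat) (V : {vspace 'rV[rat]_(m + n)}) : \dim V = m ->
  exists2 U : 'M[int]_(m + n), U \in unitmx & V = rowspace (map_mx intr (usubmx U)).
Proof.
move=> /ex_rowspace[A Af ->].
have [q q0 [N NA]] := clear_denominators A.
have [L Lu [R Ru [s _ NE]]] := int_Smith_normal_form N.
exists R => //.
have q0' : q%:~R != 0 :> rat by rewrite intr_eq0.
pose D := diag_mx (\row_(i < m) s`_i).
have {}NE : N = L *m D *m usubmx R.
  rewrite NE -!mulmxA; congr (_ *m _).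
  apply/matrixP => i j; rewrite mul_diag_mx !mxE.
  rewrite (bigD1 (lshift n i)) //= big1 ?addr0 => [|k].
    by rewrite !mxE eqxx.
  by rewrite !mxE -val_eqE /= eq_sym => /negPf ->; rewrite mulr0n mul0r.
have Nf : row_free (map_mx (intr : int -> rat) N).
  by rewrite NA /row_free mxrank_scale_nz.
(* [N] has rank [m] and factors through the square matrix [L *m D], which is therefore invertible
   over the rationals, though in general not over the integers. *)
have LDu : map_mx (intr : int -> rat) (L *m D) \in unitmx.
  rewrite -row_free_unit -row_leq_rank -{1}(eqP Nf) NE map_mxM.
  exact: mxrankM_maxl.
rewrite -[RHS](rowspace_unitmx _ LDu) -map_mxM -NE NA -mul_scalar_mx rowspace_unitmx //.
by rewrite unitmxE det_scalar unitfE expf_neq0.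
Qed.

(** * Determinants of symplectic matrices *)

Definition std_form (R : pzRingType) (n : nat) : 'M[R]_(n + n) :=
  block_mx 0 1%:M (- 1%:M) 0.

Lemma gram_block (R : comPzRingType) (m n : nat) (X Y : 'M[R]_(m, n)) (D : 'M[R]_n)
    (Z W : 'M[R]_(m, n)) :
  block_mx X Y Z W *m block_mx 0 D (- D) 0 *m (block_mx X Y Z W)^T =
  block_mx (X *m D *m Y^T - Y *m D *m X^T) (X *m D *m W^T - Y *m D *m Z^T)
           (Z *m D *m Y^T - W *m D *m X^T) (Z *m D *m W^T - W *m D *m Z^T).
Proof.
rewrite tr_block_mx !mulmx_block !mulmx0 !add0r !addr0 !mulmxN !mulNmx.
by congr block_mx; rewrite addrC.
Qed.

Lemma mulmx_tr_eq0 (R : realDomainType) (n : nat) (v : 'rV[R]_n) :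
  (v *m v^T) 0 0 <= 0 -> v = 0.
Proof.
move=> h; apply/rowP => i; rewrite mxE; apply/eqP.
have sq0 j : true -> 0 <= v 0 j * v^T j 0 by rewrite mxE -expr2 sqr_ge0.
have : (v *m v^T) 0 0 == 0 by rewrite eq_le h mxE sumr_ge0.
rewrite mxE psumr_eq0 // => /allP/(_ i (mem_index_enum _)).
by rewrite mxE -expr2 sqrf_eq0.
Qed.

(** Conjugation by the unipotent block matrix with off-diagonal block [i] makes the matrix block
    triangular. *)
Lemma det_complex_block (R : comPzRingType) (n : nat) (i : R) (A B : 'M[R]_n) :
  i ^+ 2 = -1 ->
  \det (block_mx A (- B) B A) = \det (A + i *: B) * \det (A - i *: B).
Proof.
move=> ii.
have : block_mx 1%:M i%:M 0 1%:M *m block_mx A (- B) B A *m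
    block_mx 1%:M (- i%:M) 0 1%:M = block_mx (A + i *: B) 0 B (A - i *: B).
  rewrite !mulmx_block !mulmx0 !mul0mx !mulmx1 !mul1mx !add0r !addr0 !mulmxN.
  rewrite !mul_scalar_mx !mul_mx_scalar; congr block_mx; last by rewrite addrC.
  by rewrite scalerDr scalerA -expr2 ii scaleN1r [- B + _]addrC addNr.
move=> /(congr1 determinant).
by rewrite !det_mulmx !det_ublock det_lblock !det1 !mul1r mulr1.
Qed.

(* With U = [[X, Y], [Z, W]], multiplying U by K = [[X^T, -Y^T], [Y^T, X^T]] gives
   a block lower triangular matrix with diagonal blocks P = X X^T + Y Y^T > 0 and
   1, while both det K and det P equal det (X + iY) * det (X - iY). *)
Lemma det_symplectic (n : nat) (U : 'M[rat]_(n + n)) :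
  U *m std_form rat n *m U^T = std_form rat n -> \det U = 1.
Proof.
move=> UJ; have := UJ; rewrite -[U]submxK.
set X := ulsubmx U; set Y := ursubmx U; set Z := dlsubmx U; set W := drsubmx U.
rewrite /std_form gram_block !mulmx1 => /eq_block_mx[/eqP XY _ ZW _].
have {}XY : X *m Y^T = Y *m X^T by apply/eqP; rewrite -subr_eq0.
have {}ZW : W *m X^T - Z *m Y^T = 1%:M by rewrite -opprB ZW opprK.
pose P := X *m X^T + Y *m Y^T.
have P0 : \det P != 0.
  (* If [v] is killed by [P], then |vX|^2 + |vY|^2 = 0, so (v, 0) is killed by [U], hence by the
     form itself, which forces v = 0. *)
  apply/det0P => -[v /eqP v0 vP]; apply: v0.
  have : (v *m P *m v^T) 0 0 = 0 by rewrite vP mul0mx mxE.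
  have -> : v *m P *m v^T = v *m X *m (v *m X)^T + v *m Y *m (v *m Y)^T.
    by rewrite !trmx_mul mulmxDr mulmxDl !mulmxA.
  have ge0 (w : 'rV[rat]_n) : 0 <= (w *m w^T) 0 0.
    by rewrite mxE sumr_ge0 // => j _; rewrite mxE -expr2 sqr_ge0.
  rewrite mxE => S0.
  have vX : v *m X = 0 by apply: mulmx_tr_eq0; rewrite -S0 lerDl.
  have vY : v *m Y = 0 by apply: mulmx_tr_eq0; rewrite -S0 lerDr.
  have vU : row_mx v 0 *m U = 0.
    by rewrite -[U]submxK mul_row_block !mul0mx !addr0 vX vY row_mx0.
  have : row_mx v 0 *m std_form rat n = 0 by rewrite -UJ !mulmxA vU !mul0mx.
  rewrite /std_form mul_row_block !mul0mx !mulmx0 !addr0 mulmx1 -row_mx0.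
  by move=> /eq_row_mx[].
pose K := block_mx X^T (- Y^T) Y^T X^T.
have UK : \det U * \det K = \det P.
  rewrite -[U]submxK -det_mulmx mulmx_block !mulmxN -/X -/Y XY addNr.
  by rewrite [- _ + _]addrC ZW det_lblock det1 mulr1.
have KP : \det K = \det P.
  (* Passing to [algC] supplies a square root of -1. *)
  apply: (fmorph_inj (ratr : {rmorphism rat -> algC})); rewrite -!det_map_mx.
  rewrite map_block_mx map_mxN (det_complex_block _ _ (@sqrCi _)) map_mxD.
  rewrite !map_mxM -!map_trmx.
  set x := map_mx _ X; set y := map_mx _ Y.
  have yx : x *m y^T = y *m x^T by rewrite !map_trmx -!map_mxM XY.
  have trD a : (x + a *: y)^T = x^T + a *: y^T by rewrite linearD linearZ.
  have -> : x *m x^T + y *m y^T = (x + 'i *: y) *m (x - 'i *: y)^T.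
    rewrite -scaleNr trD mulmxDl !mulmxDr -!scalemxAl -!scalemxAr yx.
    by rewrite addrA scaleNr addrNK scalerA mulrN -expr2 sqrCi opprK scale1r.
  by rewrite det_mulmx -[\det (x + _)]det_tr -!scaleNr !trD.
by rewrite submxK; apply: (mulIf P0); rewrite mul1r -{1}KP.
Qed.

(** * Valuations and divisor chains *)

Lemma squarefree_logn (n p : nat) :
  (0 < n)%N -> squarefree n -> prime p -> (logn p n <= 1)%N.
Proof.
move=> n0 sf pp; rewrite leqNgt -pfactor_dvdn //; apply/negP => /sf p1.
by rewrite p1 in pp.
Qed.

Lemma coprime_prodl (d : nat -> nat) (i j k : nat) :
  (forall n, (i <= n < j)%N -> coprime (d n) k) ->
  coprime (\prod_(i <= n < j) d n) k.
Proof.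
move=> dk; rewrite big_seq; elim/big_ind: _ => [|x y hx hy|n]; first exact: coprime1n.
  by rewrite coprimeMl hx.
by rewrite mem_index_iota => /dk.
Qed.

Lemma dprod_cat (d : nat -> nat) (i j : nat) :
  (i <= j)%N -> dprod d 1 j = (dprod d 1 i * dprod d i.+1 j)%N.
Proof. by move=> ij; rewrite /dprod (@big_cat_nat _ _ _ i.+1). Qed.

Lemma dprod_gt0 (d : nat -> nat) (i j : nat) :
  (forall n, (i <= n <= j)%N -> (0 < d n)%N) -> (0 < dprod d i j)%N.
Proof.
move=> d0; rewrite /dprod big_seq; apply: prodn_cond_gt0 => n.
by rewrite mem_index_iota => /d0.
Qed.

Lemma dprod_coprime (d : nat -> nat) (i j k : nat) :
  (forall m n, (1 <= m <= k)%N -> (1 <= n <= k)%N -> m <> n -> coprime (d m) (d n)) ->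
  (i <= j)%N -> (j <= k)%N -> coprime (dprod d 1 i) (dprod d j.+1 k).
Proof.
move=> co ij jk; apply: coprime_prodl => m hm; rewrite coprime_sym.
apply: coprime_prodl => n hn; apply: co; lia.
Qed.

(** By coprimality [p] divides at most one of the partial product and the next factor, so the
    valuation of the new product is that of one of the two. *)
Lemma dprod_logn (d : nat -> nat) (k p : nat) :
  (forall n, (1 <= n <= k)%N -> (0 < d n)%N) ->
  (forall n, (1 <= n <= k)%N -> squarefree (d n)) ->
  (forall m n, (1 <= m <= k)%N -> (1 <= n <= k)%N -> m <> n -> coprime (d m) (d n)) ->
  prime p -> (logn p (dprod d 1 k) <= 1)%N.
Proof.
move=> d0 sf co pp; elim: k d0 sf co => [|k IH] d0 sf co.
  by rewrite /dprod big_nil logn1.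
have E : dprod d 1 k.+1 = (dprod d 1 k * d k.+1)%N by rewrite /dprod big_nat_recr.
have cop : coprime (dprod d 1 k) (d k.+1).
  by have := dprod_coprime co (leqnn k) (leqnSn k); rewrite {2}/dprod big_nat1.
have Hk : (logn p (dprod d 1 k) <= 1)%N.
  by apply: IH => [n ?|n ?|m n ? ? ?]; [apply: d0|apply: sf|apply: co] => //; lia.
have Hk1 : (logn p (d k.+1) <= 1)%N.
  by apply: squarefree_logn => //; [apply: d0|apply: sf]; lia.
have P0 : (0 < dprod d 1 k)%N by apply: dprod_gt0 => n hn; apply: d0; lia.
have [pd|pd] := boolP (p %| dprod d 1 k)%N.
  rewrite E mulnC logn_Gauss //; exact: coprime_dvdl cop.
by rewrite E logn_Gauss // prime_coprime.
Qed.

(* At each prime both chains of valuations are nondecreasing with values 0 and 1,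
   hence pointwise comparable; equal products make them equal. *)
Lemma divisor_chains_eq (g D : nat) (a b : nat -> nat) :
  (0 < D)%N -> (forall p, prime p -> (logn p D <= 1)%N) ->
  {homo a : i j / (i <= j)%N >-> (i %| j)%N} ->
  {homo b : i j / (i <= j)%N >-> (i %| j)%N} ->
  (forall i, (i < g)%N -> (a i %| D)%N) -> (forall i, (i < g)%N -> (b i %| D)%N) ->
  (\prod_(i < g) a i = \prod_(i < g) b i)%N ->
  forall i : nat, (i < g)%N -> a i = b i.
Proof.
move=> D0 sfD ha hb aD bD ab.
have gt0 (c : nat -> nat) i : (forall i, (i < g)%N -> (c i %| D)%N) ->
    (i < g)%N -> (0 < c i)%N.
  by move=> cD /cD; apply: dvdn_gt0.
have mono (c : nat -> nat) p : {homo c : i j / (i <= j)%N >-> (i %| j)%N} ->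
    (forall i, (i < g)%N -> (c i %| D)%N) ->
    forall i j : nat, (i <= j)%N -> (j < g)%N -> (logn p (c i) <= logn p (c j))%N.
  by move=> hc cD i j ij jg; apply: dvdn_leq_log (hc _ _ ij); apply: gt0 jg.
have le1 (c : nat -> nat) p i : prime p -> (forall i, (i < g)%N -> (c i %| D)%N) ->
    (i < g)%N -> (logn p (c i) <= 1)%N.
  move=> pp cD ig; apply: leq_trans (sfD p pp); exact: dvdn_leq_log (cD _ ig).
have lsum (c : nat -> nat) p : (forall i, (i < g)%N -> (c i %| D)%N) ->
    logn p (\prod_(i < g) c i) = (\sum_(i < g) logn p (c i))%N.
  (* [K] carries positivity along the product, since [lognM] needs positive factors. *)
  move=> cD; pose K x y := (0 < x)%N && (logn p x == y).
  suff /andP[_ /eqP] : K (\prod_(i < g) c i)%N (\sum_(i < g) logn p (c i))%N by [].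
  elim/big_rec2: _ => [|i y x _ /andP[y0 /eqP yx]]; first by rewrite /K logn1.
  by rewrite /K muln_gt0 gt0 //= y0 lognM ?gt0 // yx eqxx.
move=> i ig; apply: eqn_from_log => [||p]; [exact: gt0|exact: gt0|].
have [pp|/negPf pp] := boolP (prime p); last by rewrite [LHS]lognE [RHS]lognE pp.
have key (c e : nat -> nat) : (forall i, (i < g)%N -> (c i %| D)%N) ->
    (forall i, (i < g)%N -> (e i %| D)%N) ->
    (\prod_(i < g) c i = \prod_(i < g) e i)%N ->
    (forall j, (j < g)%N -> (logn p (c j) <= logn p (e j))%N) ->
    logn p (c i) = logn p (e i).
  move=> cD eD ce le.
  have := leqif_sum (fun (j : 'I_g) (_ : true) => leqif_eq (le j (ltn_ord j))).
  rewrite -!lsum // ce => -[_]; rewrite eqxx => /esym/forallP/(_ (Ordinal ig)).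
  by move=> /= /eqP.
have [/forallP le|/forallPn[j]] :=
    boolP [forall j : 'I_g, logn p (a j) <= logn p (b j)]%N.
  by apply: key => // j jg; apply: (le (Ordinal jg)).
(* Here [b j] has valuation 0 and [a j] has valuation 1. By monotonicity [b] has valuation 0 up to
   [j] and [a] has valuation 1 from [j] on, so the reverse comparison holds everywhere. *)
rewrite -ltnNge => lt; apply/esym; apply: key => // k kg.
have [kj|/ltnW jk] := leqP k j.
  have := mono b p hb bD _ _ kj (ltn_ord j); have := le1 a p j pp aD (ltn_ord j); lia.
have := mono a p ha aD _ _ jk kg; have := le1 b p k pp bD kg; lia.
Qed.

(** * Smith form and Gram matrices *)

Lemma Smith_form_nat (n : nat) (A : 'M[int]_n) :
  exists2 L : 'M_n, L \in unitmx & exists2 R : 'M_n, R \in unitmx &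
  exists2 a : nat -> nat, {homo a : i j / (i <= j)%N >-> (i %| j)%N} &
  A = L *m diag_mx (\row_(i < n) (a i)%:Z) *m R.
Proof.
have [L Lu [R Ru [s ss ->]]] := int_Smith_normal_form A.
(* The signs of the diagonal entries form a unimodular matrix, which is absorbed into the right
   factor. *)
pose e : 'M[int]_n := diag_mx (\row_(i < n) (-1) ^+ (s`_i < 0)%R).
have eu : e \in unitmx.
  rewrite unitmxE det_diag; apply: rpred_prod => i _; rewrite mxE; exact: rpredX.
exists L => //; exists (e *m R); first by rewrite unitmx_mul eu.
exists (fun i => absz s`_i) => [i j ij|].
  (* Past the end of [s] the default entry is 0, which everything divides. *)
  have [js|js] := ltnP j (size s); last by rewrite (nth_default _ js) dvdn0.
  apply: (sorted_leq_nth (leT := dvdz)) => //=.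
  - exact: dvdz_trans.
  - exact: dvdzz.
  - exact: leq_ltn_trans js.
rewrite !mulmxA; congr (_ *m _); rewrite -mulmxA; congr (_ *m _).
rewrite /e mulmx_diag; apply/matrixP => i j; rewrite !mxE.
by rewrite mulrC -intEsign.
Qed.

Lemma gram_col_mx (R : comPzRingType) (m1 m2 n : nat) (X : 'M[R]_(m1, n))
    (Y : 'M[R]_(m2, n))
    (J : 'M[R]_n) :
  col_mx X Y *m J *m (col_mx X Y)^T =
  block_mx (X *m J *m X^T) (X *m J *m Y^T) (Y *m J *m X^T) (Y *m J *m Y^T).
Proof. by rewrite tr_col_mx mul_col_mx mul_col_row. Qed.

Lemma tr_pol_Lambda (g : nat) (d : nat -> nat) : (pol_Lambda g d)^T = - pol_Lambda g d.
Proof.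
rewrite /pol_Lambda tr_block_mx !linearN /= !tr_diag_mx !linear0.
by rewrite opp_block_mx opprK !oppr0.
Qed.

Lemma pol_form_tr (g m n : nat) (d : nat -> nat) (X : 'M_(m, g + g))
    (Y : 'M_(n, g + g)) :
  (X *m pol_Lambda g d *m Y^T)^T = - (Y *m pol_Lambda g d *m X^T).
Proof. by rewrite !trmx_mul trmxK tr_pol_Lambda mulNmx mulmxN mulmxA. Qed.

Lemma pol_form_alt (g n : nat) (d : nat -> nat) (Y : 'M_(n, g + g)) i :
  (Y *m pol_Lambda g d *m Y^T) i i = 0.
Proof.
have /matrixP/(_ i i) := pol_form_tr d Y Y; rewrite mxE [in RHS]mxE => /eqP.
by rewrite -addr_eq0 -mulr2n mulrn_eq0 => /eqP.
Qed.

(** The entry d_{1:i} of [pol_Delta] divides d_{1:g-1} with cofactor d_{i+1:g-1}, so the cofactors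
    give an integral multiple of the inverse form. *)
Lemma pol_Lambda_adj (g : nat) (d : nat -> nat) :
  exists L : 'M_(g + g), pol_Lambda g d *m L = (dprod d 1 g.-1)%:Z%:M.
Proof.
pose E : 'M[int]_g := diag_mx (\row_(i < g) (dprod d i.+1 g.-1)%:Z).
have DE : pol_Delta g d *m E = (dprod d 1 g.-1)%:Z%:M.
  rewrite /pol_Delta mulmx_diag; apply/matrixP => i j; rewrite !mxE.
  by rewrite -PoszM -dprod_cat //; have := ltn_ord i; lia.
exists (block_mx 0 (- E) E 0).
rewrite mulmx_block !mulmx0 !mul0mx !addr0 !add0r mulNmx mulmxN opprK DE.
by rewrite -scalar_mx_block.
Qed.

Lemma det_unitmx_sq (n : nat) (U : 'M[int]_n) : U \in unitmx -> \det U * \det U = 1.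
Proof. by rewrite unitmxE qualifE /= => /orP[] /eqP->. Qed.

Lemma det_diag_nat (n : nat) (a : nat -> nat) :
  \det (diag_mx (\row_(i < n) (a i)%:Z)) = (\prod_(i < n) a i)%N%:Z.
Proof.
rewrite det_diag (big_morph Posz PoszM erefl).
by apply: eq_bigr => i _; rewrite mxE.
Qed.

Lemma gram_lagrangian (g : nat) (d a : nat -> nat) (X Y : 'M[int]_(g, g + g))
    (A := diag_mx (\row_(i < g) (a i)%:Z)) :
  X *m pol_Lambda g d *m X^T = 0 ->
  X *m pol_Lambda g d *m Y^T = A ->
  col_mx X Y *m pol_Lambda g d *m (col_mx X Y)^T =
    block_mx 0 A (- A) (Y *m pol_Lambda g d *m Y^T).
Proof.
move=> XX XY.
rewrite gram_col_mx XX XY; congr block_mx.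
by rewrite -[LHS]trmxK pol_form_tr XY linearN /= tr_diag_mx.
Qed.

Lemma gram_det (g : nat) (d a : nat -> nat) (X Y : 'M[int]_(g, g + g)) :
  col_mx X Y \in unitmx ->
  X *m pol_Lambda g d *m X^T = 0 ->
  X *m pol_Lambda g d *m Y^T = diag_mx (\row_(i < g) (a i)%:Z) ->
  (\prod_(i < g) a i = \prod_(i < g) dprod d 1 i)%N.
Proof.
(* Multiplication by [S] swaps the block columns and makes both Gram matrices block triangular. The
   common sign cancels and leaves the squares of the two products. *)
move=> XYu XX XY; pose S : 'M[int]_(g + g) := block_mx 0 1%:M 1%:M 0.
have detN (C : 'M[int]_g) : \det C * \det (- C) = (-1) ^+ g * (\det C) ^+ 2.
  by rewrite -scaleN1r detZ mulrCA expr2.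
have := congr1 (fun M => \det M * \det S) (gram_lagrangian XX XY).
rewrite /= 2!det_mulmx det_tr (mulrAC (\det (col_mx X Y))) det_unitmx_sq // mul1r.
rewrite -!det_mulmx.
rewrite !mulmx_block !mulmx0 !mulmx1 !addr0 !add0r det_ublock det_lblock.
rewrite !detN => /(mulrI (unitrX _ (unitrN1 _))); rewrite /pol_Delta !det_diag_nat.
by move=> /eqP; rewrite eqrXn2 // eqz_nat => /eqP.
Qed.

(** Let G be the Gram matrix of (X, Y). The lower left block of the integral matrix D G^-1 is D
    A^-1, whence a_i divides D; its upper left block has entries D B_ik / (a_i a_k). *)
Lemma gram_divisible (g : nat) (d a : nat -> nat) (X Y : 'M[int]_(g, g + g))
    (D := dprod d 1 g.-1) (B := Y *m pol_Lambda g d *m Y^T) :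
  (0 < D)%N -> col_mx X Y \in unitmx ->
  X *m pol_Lambda g d *m X^T = 0 ->
  X *m pol_Lambda g d *m Y^T = diag_mx (\row_(i < g) (a i)%:Z) ->
  (forall i : 'I_g, (a i %| D)%N) /\
  (forall i k : 'I_g, ((a i)%:Z * (a k)%:Z %| D%:Z * B i k)%Z).
Proof.
move=> D0 XYu XX XY; have [L LE] := pol_Lambda_adj g d.
pose U := col_mx X Y; have Uu : U \in unitmx := XYu.
pose H := invmx U^T *m L *m invmx U.
pose A : 'M[int]_g := diag_mx (\row_(i < g) (a i)%:Z).
have : block_mx 0 A (- A) B *m H = D%:Z%:M.
  rewrite -(gram_lagrangian XX XY) -/U /H !mulmxA mulmxK ?unitmx_tr //.
  by rewrite -[U *m _ *m L]mulmxA LE mul_mx_scalar -scalemxAl mulmxV // scalemx1.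
rewrite -[H]submxK mulmx_block !mul0mx !add0r scalar_mx_block.
move: (ulsubmx H) (dlsubmx H) => H1 H2 /eq_block_mx[AH _ BH _].
have AHE (i k : 'I_g) : (a i)%:Z * H2 i k = D%:Z *+ (i == k).
  by have /matrixP/(_ i k) := AH; rewrite mul_diag_mx !mxE.
have an0 (i : 'I_g) : (a i)%:Z != 0.
  apply/eqP => ai0; have := AHE i i; rewrite ai0 mul0r eqxx => /eqP.
  by rewrite eq_sym eqz_nat => /eqP D0'; rewrite D0' in D0.
have H20 i k : i != k -> H2 i k = 0.
  move=> /negPf ik; have /eqP := AHE i k.
  by rewrite ik mulr0n mulf_eq0 (negPf (an0 i)) => /eqP.
split=> [i|i k].
  have : ((a i)%:Z %| D%:Z)%Z by apply/dvdzP; exists (H2 i i); rewrite mulrC AHE eqxx.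
  by [].
have : (a i)%:Z * H1 i k = B i k * H2 k k.
  have <- : (A *m H1) i k = (a i)%:Z * H1 i k by rewrite mul_diag_mx !mxE.
  have -> : A *m H1 = B *m H2 by apply/esym/subr0_eq; rewrite addrC -mulNmx.
  by rewrite mxE (bigD1 k) //= big1 ?addr0 // => j jk; rewrite H20 ?mulr0.
move=> E; apply/dvdzP; exists (H1 i k).
have := AHE k k; rewrite eqxx mulr1n => <-; rewrite mulrAC -mulrA -E; ring.
Qed.


(** * Symplectic bases adapted to a Lagrangian *)

(** When X is isotropic and pairs with Y by [D], replacing Y by Y + C X adds C D - D C^T to the Gram
    matrix of Y; this decomposition makes the sum vanish. *)
Lemma alternating_decomposition (n : nat) (a : nat -> nat) (B : 'M[int]_n)
    (D := diag_mx (\row_(i < n) (a i)%:Z)) :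
  B^T = - B -> (forall i, B i i = 0) ->
  (forall i k : 'I_n, (i <= k)%N -> ((a i)%:Z %| B i k)%Z) ->
  exists C : 'M_n, B = D *m C^T - C *m D.
Proof.
move=> BT B0 dvdB.
(* [C] is strictly lower triangular: [D *m C^T] accounts for the entries above the diagonal and
   [C *m D] for those below. *)
exists (\matrix_(k, i) if (i < k)%N then (B i k %/ (a i)%:Z)%Z else 0).
apply/matrixP => i k; rewrite mul_diag_mx mul_mx_diag !mxE.
case: (ltngtP i k) => ik.
- by rewrite mul0r subr0 mulrC divzK // dvdB // ltnW.
- rewrite mulr0 sub0r divzK ?dvdB ?(ltnW ik) //.
  by have /matrixP/(_ k i) := BT; rewrite !mxE.
- by rewrite (val_inj ik) mulr0 mul0r subr0 B0.
Qed.

(** Since [P] is unimodular, the first half of the new basis spans the same subspace as [X]. *)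
Lemma lagrangian_symplectic_basis (g : nat) (d : nat -> nat)
    (X Y : 'M[int]_(g, g + g)) :
  (forall i : nat, (1 <= i <= g.-1)%N -> (0 < d i)%N) ->
  (forall i : nat, (1 <= i <= g.-1)%N -> squarefree (d i)) ->
  (forall i j : nat, (1 <= i <= g.-1)%N -> (1 <= j <= g.-1)%N ->
     i <> j -> coprime (d i) (d j)) ->
  col_mx X Y \in unitmx -> X *m pol_Lambda g d *m X^T = 0 ->
  exists2 P : 'M_g, P \in unitmx & exists Z : 'M_(g, g + g),
    let U := col_mx (P *m X) Z in U *m pol_Lambda g d *m U^T = pol_Lambda g d.
Proof.
move=> d0 sf co XYu XX.
have [L Lu [R Ru [a ha XYE]]] := Smith_form_nat (X *m pol_Lambda g d *m Y^T).
pose X1 := invmx L *m X; pose Y1 := (invmx R)^T *m Y.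
have XX1 : X1 *m pol_Lambda g d *m X1^T = 0.
  by rewrite /X1 trmx_mul -!mulmxA [X *m _]mulmxA [X *m _ *m _]mulmxA XX mul0mx mulmx0.
have XY1 : X1 *m pol_Lambda g d *m Y1^T = diag_mx (\row_(i < g) (a i)%:Z).
  rewrite /X1 /Y1 trmx_mul trmxK -!mulmxA [X *m _]mulmxA [X *m _ *m _]mulmxA XYE.
  by rewrite !mulmxA mulVmx // mul1mx mulmxK.
have XYu1 : col_mx X1 Y1 \in unitmx.
  have -> : col_mx X1 Y1 = block_mx (invmx L) 0 0 (invmx R)^T *m col_mx X Y.
    by rewrite mul_block_col !mul0mx addr0 add0r.
  rewrite unitmx_mul XYu andbT unitmxE det_ublock det_tr unitrM -!unitmxE.
  by rewrite !unitmx_inv Lu.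
have X1E : X1 = invmx L *m X by [].
clearbody X1 Y1; clear XYE; pose D := dprod d 1 g.-1.
have D0 : (0 < D)%N by apply: dprod_gt0.
have [aD aaB] := gram_divisible D0 XYu1 XX1 XY1.
have dD (i : nat) : (i < g)%N -> (dprod d 1 i * dprod d i.+1 g.-1 = D)%N.
  by move=> ig; rewrite -dprod_cat //; lia.
have aE : forall i : nat, (i < g)%N -> a i = dprod d 1 i.
  apply: (divisor_chains_eq D0) => //.
  - by move=> p pp; apply: dprod_logn.
  - by move=> i j ij; rewrite (@dprod_cat d i j) // dvdn_mulr.
  - by move=> i ig; apply: (aD (Ordinal ig)).
  - by move=> i ig; rewrite -(dD i ig) dvdn_mulr.
  - exact: gram_det XYu1 XX1 XY1.
have {}XY1 : X1 *m pol_Lambda g d *m Y1^T = pol_Delta g d.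
  by rewrite XY1 /pol_Delta; congr diag_mx; apply/rowP => i; rewrite !mxE aE.
pose B := Y1 *m pol_Lambda g d *m Y1^T.
have dvdB (i k : 'I_g) : (i <= k)%N -> ((dprod d 1 i)%:Z %| B i k)%Z.
  (* Cancelling d_{1:k} from a_i a_k | D B_ik leaves d_{1:i} | d_{k+1:g-1} B_ik, and d_{1:i} is
     coprime to d_{k+1:g-1}. *)
  move=> ik; have := aaB i k; rewrite !aE // -/B -/D -(dD k) // PoszM -mulrA mulrC.
  rewrite dvdz_mul2r; last first.
    rewrite eqz_nat -lt0n; apply: dprod_gt0 => n hn; apply: d0.
    by have := ltn_ord k; lia.
  rewrite Gauss_dvdzr // /coprimez; apply: dprod_coprime => //.
  by have := ltn_ord k; lia.
have [C BE] : exists C : 'M_g, B = pol_Delta g d *m C^T - C *m pol_Delta g d.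
  by apply: alternating_decomposition dvdB; [exact: pol_form_tr|exact: pol_form_alt].
exists (invmx L); first by rewrite unitmx_inv.
exists (Y1 + C *m X1); rewrite /= -X1E gram_col_mx XX1.
have XY2 : X1 *m pol_Lambda g d *m (Y1 + C *m X1)^T = pol_Delta g d.
  by rewrite linearD /= trmx_mul mulmxDr XY1 mulmxA XX1 mul0mx addr0.
have YX1 : Y1 *m pol_Lambda g d *m X1^T = - pol_Delta g d.
  by rewrite -[LHS]trmxK pol_form_tr XY1 linearN /= tr_diag_mx.
rewrite XY2 !mulmxDl -!(mulmxA C) XX1 XY2 mulmx0 addr0 YX1; congr block_mx.
rewrite linearD /= trmx_mul mulmxDr -/B mulmxA YX1 BE mulNmx addrAC.
by rewrite subrK subrr.
Qed.

(** Over the rationals the block matrix diag(1, Delta) carries the standard form to Lambda, so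
    conjugating [M] by it gives a symplectic matrix of the same determinant. *)
Lemma det_pol_isometry (g : nat) (d : nat -> nat) (M : 'M_(g + g)) :
  (forall i : nat, (1 <= i <= g.-1)%N -> (0 < d i)%N) ->
  M *m pol_Lambda g d *m M^T = pol_Lambda g d -> \det M = 1.
Proof.
move=> d0 ML; pose f (n : nat) := @map_mx int rat intr n n.
pose E : 'M_(g + g) := block_mx 1%:M 0 0 (f g (pol_Delta g d)).
have Eu : E \in unitmx.
  rewrite unitmxE det_ublock det1 mul1r unitfE det_map_mx intr_eq0 /pol_Delta.
  rewrite det_diag_nat eqz_nat -lt0n; apply: prodn_gt0 => i.
  by apply: dprod_gt0 => n hn; apply: d0; have := ltn_ord i; lia.
have EJ : E *m std_form rat g *m E^T = f _ (pol_Lambda g d).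
  rewrite /E /std_form gram_block !trmx1 !trmx0 !mulmx0 !mul0mx !mulmx1 !mul1mx.
  rewrite !subr0 !sub0r /f map_block_mx !map_mx0 map_mxN.
  by congr block_mx; rewrite map_trmx /pol_Delta tr_diag_mx.
apply: (@intr_inj rat); rewrite -det_map_mx.
have [N EN] : exists N, E *m N = f _ M *m E.
  by exists (invmx E *m f _ M *m E); rewrite !mulmxA mulmxV // mul1mx.
have <- : \det N = \det (f _ M).
  by apply: (mulIr Eu); rewrite -!det_mulmx -EN !det_mulmx mulrC.
apply: det_symplectic; apply: (can_inj (mulKmx Eu)).
have Etu : E^T \in unitmx by rewrite unitmx_tr.
apply: (can_inj (mulmxK Etu)); rewrite EJ !mulmxA EN -mulmxA -trmx_mul EN trmx_mul.
by rewrite -!mulmxA [std_form _ _ *m _]mulmxA [E *m (_ *m _)]mulmxA [E *m _]mulmxA EJ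
  mulmxA /f map_trmx -!map_mxM ML.
Qed.

(** * Transitivity on Lagrangian subspaces *)

Theorem theorem5p3 (g : nat) (d : nat -> nat)
    (g_gt0 : (0 < g)%N)
    (d_gt0 : forall i : nat, (1 <= i <= g.-1)%N -> (0 < d i)%N)
    (d_sqfree : forall i : nat, (1 <= i <= g.-1)%N -> squarefree (d i))
    (d_coprime : forall i j : nat, (1 <= i <= g.-1)%N -> (1 <= j <= g.-1)%N ->
       i <> j -> coprime (d i) (d j)) :
  acts_transitively (Gamma_pol (g:=g) d) (@subspace_act (g + g))
    (fun V : {vspace 'rV[rat]_(g + g)} => isotropic d V /\ \dim V = g).
Proof.
split=> [V M [Viso dimV] [detM ML]||V W [Viso dimV] [Wiso dimW]].
- have [A Af VE] := ex_rowspace dimV; rewrite VE subspace_act_rowspace.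
  have Mu : M \in unitmx by rewrite unitmxE detM unitr1.
  split; last first.
    apply: dim_rowspace; rewrite /row_free mxrankMfree // row_free_unit.
    by rewrite unitmxE det_map_mx detM unitr1.
  move: Viso; rewrite VE => /isotropic_rowspace Aiso; apply/isotropic_rowspace.
  rewrite trmx_mul -!mulmxA [map_mx intr M *m (_ *m _)]mulmxA.
  rewrite [_ *m ((map_mx _ _)^T *m _)]mulmxA.
  by rewrite map_trmx -!map_mxM ML mulmxA.
(* The first g coordinate vectors span a Lagrangian, as the upper left block of Lambda is 0. *)
- exists (rowspace (row_mx 1%:M 0)); split.
    apply/isotropic_rowspace; rewrite /pol_Lambda map_block_mx tr_row_mx.
    rewrite mul_row_block !mul0mx !map_mx0 !mulmx0 !addr0.
    by rewrite mul_row_col trmx0 mul0mx mulmx0 addr0.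
  apply: dim_rowspace; apply/row_freeP; exists (col_mx 1%:M 0).
  by rewrite mul_row_col mul1mx mul0mx addr0.
have normal (V' : {vspace 'rV[rat]_(g + g)}) : isotropic d V' -> \dim V' = g ->
    exists2 U : 'M[int]_(g + g), U *m pol_Lambda g d *m U^T = pol_Lambda g d &
    V' = rowspace (map_mx intr (usubmx U)).
  move=> V'iso /primitive_basis[U Uu V'E]; move: V'iso; rewrite V'E.
  move/isotropic_rowspace; rewrite map_trmx -!map_mxM -(map_mx0 intr).
  move=> /map_intr_inj XX.
  have [|P Pu [Z /= UL]] :=
    lagrangian_symplectic_basis d_gt0 d_sqfree d_coprime _ XX (Y := dsubmx U).
    by rewrite vsubmxK.
  exists (col_mx (P *m usubmx U) Z) => //.
  rewrite col_mxKu map_mxM rowspace_unitmx //.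
  by rewrite unitmxE det_map_mx rmorph_unit // -unitmxE.
have [U UL VE] := normal V Viso dimV; have [T TL WE] := normal W Wiso dimW.
have detU := det_pol_isometry d_gt0 UL.
have Uu : U \in unitmx by rewrite unitmxE detU unitr1.
(* [invmx U *m T] carries the rows of [U] to those of [T], and both matrices have Gram matrix
   Lambda. *)
have ML : (invmx U *m T) *m pol_Lambda g d *m (invmx U *m T)^T = pol_Lambda g d.
  rewrite trmx_mul -!mulmxA [T *m _]mulmxA [T *m _ *m _]mulmxA TL.
  by rewrite -{1}UL !mulmxA mulVmx // mul1mx trmx_inv mulmxK ?unitmx_tr.
exists (invmx U *m T); first by split=> //; apply: det_pol_isometry ML.
rewrite VE subspace_act_rowspace -map_mxM mulmxA mul_usub_mx.
by rewrite mulmxV // WE mul_usub_mx mul1mx.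
Qed.
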